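(* Let $A$ be a group which is hyperbolic relative to a collection of subgroups $\{A_\mu\}_{\mu\in \mathrm M}\cup\{K\}$, and let $B$ be a group which is hyperbolic relative to a collection of subgroups $\{B_\nu\}_{\nu\in \mathrm N}$. Assume that $K$ is finitely generated and that for some $\eta\in \mathrm N$ there is a monomorphism $\xi:K\to B_\eta$. Then the amalgamated product $A\ast_{K=\xi(K)}B$ is hyperbolic relative to $\{A_\mu\}_{\mu\in \mathrm M}\cup\{B_\nu\}_{\nu\in \mathrm N}$.
   Context: $A\ast_{K=\xi(K)}B$ is the free product of $A$ and $B$ amalgamated by identifying each $k\in K\le A$ with $\xi(k)\in B_\eta\le B$. $\mathrm M$ and $\mathrm N$ are index sets. **Relative presentations.** Let $G$ be a group, $\{H_\lambda\}_{\lambda\in\Lambda}$ a collection of subgroups of $G$ and $X\subseteq G$ a subset, always assumed symmetrized ($X^{-1}=X$). $X$ is a relative generating set of $G$ with respect to $\{H_\lambda\}_{\lambda\in\Lambda}$ if $G$ is generated by $X\cup\bigcup_{\lambda}H_\lambda$. Then $G$ is a quotient of the free product $F=(\ast_{\lambda\in\Lambda}H_\lambda)\ast F(X)$, where $F(X)$ is the free group with basis $X$. If the kernel of the natural homomorphism $F\to G$ is the normal closure in $F$ of a subset $\mathcal R$, one says that $G$ has the relative presentation $\langle X, H_\lambda,\lambda\in\Lambda\mid\mathcal R\rangle$. It is finite if $X$ and $\mathcal R$ are finite (there is no finiteness restriction on $\Lambda$ or on the $H_\lambda$); if a finite relative presentation exists, $G$ is said to be finitely presented relative to $\{H_\lambda\}_{\lambda\in\Lambda}$.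 **Relative Dehn functions.** Put $\mathcal H=\bigsqcup_{\lambda\in\Lambda}(H_\lambda\setminus\{1\})$. For a word $W$ in the alphabet $X\cup\mathcal H$ representing $1$ in $G$, the relative area $Area^{rel}(W)$ is the smallest $k$ such that $W=\prod_{i=1}^k f_i^{-1}R_i^{\pm1}f_i$ in $F$ with $R_i\in\mathcal R$, $f_i\in F$. The relative Dehn function of $G$ with respect to $\{H_\lambda\}_{\lambda\in\Lambda}$ (for a finite relative presentation) is the smallest function $f:\mathbb N\to\mathbb N$ such that $Area^{rel}(W)\le f(n)$ for every $n$ and every word $W$ in $X\cup\mathcal H$ of length at most $n$ representing $1$ in $G$; it is well-defined if these relative areas are bounded for each $n$. When well-defined, it does not depend on the finite relative presentation up to the equivalence $f\preceq g\preceq f$, where $f\preceq g$ means that there are positive constants $a,b,c$ with $f(n)\le a\,g(bn)+cn$ for all $n$. **Relative hyperbolicity.** $G$ is hyperbolic relative to $\{H_\lambda\}_{\lambda\in\Lambda}$ if the relative Dehn function of $G$ with respect to $\{H_\lambda\}_{\lambda\in\Lambda}$ is linear; that is, $G$ is finitely presented relative to $\{H_\lambda\}_{\lambda\in\Lambda}$ and its relative Dehn function is well-defined and bounded above by $cn$ for some constant $c$. *)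

(* Defs.v *)
From HB Require Import structures.
From mathcomp Require Import all_boot.
From mathcomp Require Import all_classical.

Set Implicit Arguments.
Unset Strict Implicit.
Unset Printing Implicit Defensive.

Local Open Scope classical_set_scope.
Local Open Scope group_scope.
Local Open Scope quotient_scope.

Definition is_subgroup (G : groupType) (H : set G) : Prop :=
  group_closed [in H].

Definition is_normal (G : groupType) (H : set G) : Prop :=
  is_subgroup H /\ forall x y, H x -> H (x ^ y).

Definition generated (G : groupType) (S : set G) : set G :=
  smallest (@is_subgroup G) S.

Definition normal_closure (G : groupType) (S : set G) : set G :=
  smallest (@is_normal G) S.

Definition finitely_generated (G : groupType) : Prop :=
  exists S : set G, finite_set S /\ generated S = setT.

Record subgroup (G : groupType) := Subgroup {
  sg_set : set G;
  sg_subproof : is_subgroup sg_set }.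

Definition sg_type (G : groupType) (H : subgroup G) : Type :=
  {x : G | x \in sg_set H}.
Coercion sg_type : subgroup >-> Sortclass.

HB.instance Definition _ (G : groupType) (H : subgroup G) :=
  SubChoice.on (sg_type H).
HB.instance Definition _ (G : groupType) (H : subgroup G) :=
  SubChoice_isSubGroup.Build G [in sg_set H] (sg_type H) (sg_subproof H).

Section Image.
Variables (G H : groupType) (f : {multiplicative G -> H}) (K : subgroup G).

Lemma sg_image_subproof : is_subgroup (f @` sg_set K).
Proof.
have [K1 KV] := sg_subproof K.
have f1 : f 1 = 1 by apply: (mulgI (f 1)); rewrite -gmulfM !mulg1.
have fV x : f x^-1 = (f x)^-1.
  by apply: (mulgI (f x)); rewrite -gmulfM !mulgV f1.
split=> [|_ _ /set_mem[x Kx <-] /set_mem[y Ky <-]]; rewrite inE.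
  by exists 1 => //; apply/set_mem.
exists (x / y); last by rewrite gmulfM fV.
by apply/set_mem/KV; apply/mem_set.
Qed.

Definition sg_image : subgroup H := Subgroup sg_image_subproof.
End Image.

(* The letter (s, false) stands for s and (s, true) for its inverse. *)
Definition word (S : Type) : choiceType := seq ({classic S} * bool).

Definition word_inv (S : Type) (w : word S) : word S :=
  rev [seq (a.1, ~~ a.2) | a <- w].

Definition gen_word (S : Type) (s : S) : word S := [:: (s : {classic S}, false)].

(* The least congruence on words that contains the relations rel u v, read as
   u = v, and makes (s, b) and (s, ~~ b) inverse to each other. *)
Inductive pres_eq (S : Type) (rel : word S -> word S -> Prop) :
  word S -> word S -> Prop :=
| pres_refl u : pres_eq rel u u
| pres_sym u v : pres_eq rel u v -> pres_eq rel v u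
| pres_trans u v w : pres_eq rel u v -> pres_eq rel v w -> pres_eq rel u w
| pres_cat u u' v v' : pres_eq rel u u' -> pres_eq rel v v' ->
    pres_eq rel (u ++ v) (u' ++ v')
| pres_cancel (s : {classic S}) b : pres_eq rel [:: (s, b); (s, ~~ b)] [::]
| pres_rel u v : rel u v -> pres_eq rel u v.

Section Presented.
Variables (S : Type) (rel : word S -> word S -> Prop).

Definition pres_eqb : ssrbool.rel (word S) := fun u v => `[< pres_eq rel u v >].

Lemma pres_eqb_refl : reflexive pres_eqb.
Proof. by move=> u; apply/asboolP; apply: pres_refl. Qed.

Lemma pres_eqb_sym : symmetric pres_eqb.
Proof. by move=> u v; apply/asboolP/asboolP; apply: pres_sym. Qed.

Lemma pres_eqb_trans : transitive pres_eqb.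
Proof.
by move=> u v w /asboolP vu /asboolP uw; apply/asboolP/(pres_trans vu uw).
Qed.

Canonical pres_equiv := EquivRel pres_eqb pres_eqb_refl pres_eqb_sym pres_eqb_trans.

Definition presented : Type := {eq_quot pres_equiv}.
HB.instance Definition _ := Choice.on presented.
HB.instance Definition _ := Quotient.on presented.

Lemma presentedP u v : reflect (pres_eq rel u v) (\pi_presented u == \pi_presented v).
Proof. by rewrite (@eqmodE _ pres_equiv); apply: asboolP. Qed.

Lemma presented_eq u v : pres_eq rel u v <-> \pi_presented u = \pi_presented v.
Proof. by split=> [uv|/eqP/presentedP //]; apply/eqP/presentedP. Qed.

Definition pres_mul (x y : presented) : presented :=
  \pi_presented (repr x ++ repr y : word S).
Definition pres_one : presented := \pi_presented ([::] : word S).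
Definition pres_inv (x : presented) : presented :=
  \pi_presented (word_inv (repr x)).

Lemma repr_pres u : pres_eq rel (repr (\pi_presented u)) u.
Proof. by apply/presented_eq; rewrite reprK. Qed.

Lemma pi_mul u v :
  pres_mul (\pi_presented u) (\pi_presented v) = \pi_presented (u ++ v : word S).
Proof. by apply/presented_eq/pres_cat; apply: repr_pres. Qed.

Lemma pres_mulA : associative pres_mul.
Proof.
elim/quotW=> u; elim/quotW=> v; elim/quotW=> w.
by rewrite (pi_mul v w) (pi_mul u v) (pi_mul u (v ++ w)) (pi_mul (u ++ v) w) catA.
Qed.

Lemma pres_mul1 : left_id pres_one pres_mul.
Proof. by elim/quotW=> u; apply: pi_mul. Qed.

Lemma pres_mulr1 : right_id pres_one pres_mul.
Proof. by elim/quotW=> u; rewrite [LHS]pi_mul cats0. Qed.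

Lemma word_invK : involutive (@word_inv S).
Proof.
move=> w; rewrite /word_inv map_rev revK -map_comp -[RHS]map_id.
by apply: eq_map => -[s b] /=; rewrite negbK.
Qed.

Lemma word_mulV (w : word S) : pres_eq rel (w ++ word_inv w : word S) [::].
Proof.
elim: w => [|[s b] w IH]; first exact: pres_refl.
rewrite /word_inv map_cons rev_cons -cats1 /= catA -/(word_inv w).
apply: pres_trans (pres_cancel rel s b).
apply: (@pres_cat _ _ [:: (s, b)] [:: (s, b)] _ [:: (s, ~~ b)]).
  exact: pres_refl.
by apply: (@pres_cat _ _ _ [::] _ [:: (s, ~~ b)] IH); apply: pres_refl.
Qed.

Lemma pres_mulrV : right_inverse pres_one pres_inv pres_mul.
Proof.
move=> x; rewrite -{1}[x]reprK pi_mul; apply/presented_eq.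
exact: word_mulV.
Qed.

Lemma pres_mulV : left_inverse pres_one pres_inv pres_mul.
Proof.
move=> x; rewrite -{2}[x]reprK pi_mul; apply/presented_eq.
by rewrite -{2}[repr x]word_invK; apply: word_mulV.
Qed.

HB.instance Definition _ := isGroup.Build presented
  pres_mulA pres_mul1 pres_mulr1 pres_mulV pres_mulrV.

Definition pres_gen (s : S) : presented := \pi_presented (gen_word s).

Variables (G : groupType) (f : S -> G).

Definition word_eval (w : word S) : G :=
  \prod_(a <- w) (if a.2 then (f a.1)^-1 else f a.1).

(* A homomorphism extending f only when f respects the relations, see
   [pres_liftM] and [pres_lift_gen]; junk otherwise. *)
Definition pres_lift (x : presented) : G := word_eval (repr x).

Hypothesis f_rel : forall u v, rel u v -> word_eval u = word_eval v.

Lemma word_eval_eq u v : pres_eq rel u v -> word_eval u = word_eval v.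
Proof.
elim=> {u v} [//|u v _ -> //|u v w _ -> //|u u' v v' _ e _ e'|s b|u v /f_rel //].
  by rewrite /word_eval !big_cat /=; congr (_ * _).
by rewrite /word_eval !big_cons !big_nil; case: b; rewrite /= mulg1 ?mulVg ?mulgV.
Qed.

Lemma pres_liftM : {morph pres_lift : x y / x * y}.
Proof.
move=> x y; rewrite /pres_lift.
rewrite (word_eval_eq (repr_pres _)); exact: big_cat.
Qed.

Lemma pres_lift_gen s : pres_lift (pres_gen s) = f s.
Proof.
rewrite /pres_lift (word_eval_eq (repr_pres _)) /word_eval.
by rewrite big_seq1.
Qed.
End Presented.

(* Generated by the disjoint union of A and B subject to the multiplication
   tables of A and B and to k = xi k for every k in K. *)
Inductive amalgam_rel (A B : groupType) (K : subgroup A) (H : subgroup B)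
    (xi : K -> H) :
  word (A + B) -> word (A + B) -> Prop :=
| amalgam_mull (x y : A) :
    amalgam_rel xi (gen_word (inl x) ++ gen_word (inl y)) (gen_word (inl (x * y)))
| amalgam_mulr (x y : B) :
    amalgam_rel xi (gen_word (inr x) ++ gen_word (inr y)) (gen_word (inr (x * y)))
| amalgam_glue (k : K) :
    amalgam_rel xi (gen_word (inl (val k))) (gen_word (inr (val (xi k)))).

Section Amalgam.
Variables (A B : groupType) (K : subgroup A) (H : subgroup B) (xi : K -> H).

Definition amalgam : groupType := presented (amalgam_rel xi).

Definition amalgam_inl (a : A) : amalgam := pres_gen (amalgam_rel xi) (inl a).
Definition amalgam_inr (b : B) : amalgam := pres_gen (amalgam_rel xi) (inr b).

Lemma amalgam_inlM : {morph amalgam_inl : x y / x * y}.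
Proof.
move=> x y; apply/esym; rewrite [LHS](@pi_mul _ (amalgam_rel xi)).
by apply/presented_eq/pres_rel; constructor.
Qed.

Lemma amalgam_inrM : {morph amalgam_inr : x y / x * y}.
Proof.
move=> x y; apply/esym; rewrite [LHS](@pi_mul _ (amalgam_rel xi)).
by apply/presented_eq/pres_rel; constructor.
Qed.

HB.instance Definition _ :=
  isMultiplicative.Build A amalgam amalgam_inl amalgam_inlM.
HB.instance Definition _ :=
  isMultiplicative.Build B amalgam amalgam_inr amalgam_inrM.

Lemma amalgam_glueE (k : K) : amalgam_inl (val k) = amalgam_inr (val (xi k)).
Proof. by apply/presented_eq/pres_rel; constructor. Qed.
End Amalgam.

(* F = ( * _l H l) * F(X), generated by the disjoint union of the H l and of X
   subject to the multiplication tables of the H l. As X is a basis of F(X),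
   x and x^-1 are independent in F even when both belong to X. *)
Inductive rel_free_rel (G : groupType) (L : Type) (H : L -> subgroup G)
    (X : set G) :
  word ({l : L & H l} + X) -> word ({l : L & H l} + X) -> Prop :=
| rel_free_mul (l : L) (x y : H l) :
    rel_free_rel (gen_word (inl (existT _ l x)) ++ gen_word (inl (existT _ l y)))
                 (gen_word (inl (existT _ l (x * y)))).

Section Relative.
Variables (G : groupType) (L : Type) (H : L -> subgroup G).

Definition rel_free (X : set G) : groupType :=
  presented (@rel_free_rel G L H X).

Definition rel_gen_val (X : set G) (s : {l : L & H l} + X) : G :=
  match s with inl h => val (tagged h) | inr x => val x end.

(* The natural homomorphism F -> G, see [rel_projM] and [rel_proj_gen]. *)
Definition rel_proj (X : set G) : rel_free X -> G :=
  pres_lift (@rel_gen_val X).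

Lemma rel_gen_val_rel (X : set G) u v : rel_free_rel u v ->
  word_eval (@rel_gen_val X) u = word_eval (@rel_gen_val X) v.
Proof.
by case=> l x y; rewrite /word_eval !big_cons !big_nil /= !mulg1.
Qed.

Lemma rel_projM (X : set G) : {morph @rel_proj X : u v / u * v}.
Proof. exact: (pres_liftM (@rel_gen_val_rel X)). Qed.

Lemma rel_proj_gen (X : set G) s :
  rel_proj (pres_gen (@rel_free_rel G L H X) s) = rel_gen_val s.
Proof. exact: (pres_lift_gen (@rel_gen_val_rel X)). Qed.

Definition rel_presentation (X : set G) (R : set (rel_free X)) : Prop :=
  [/\ (forall x, X x -> X x^-1),
      generated (X `|` \bigcup_l sg_set (H l)) = setT &
      [set w | rel_proj w = 1] = normal_closure R].

Definition finite_rel_presentation (X : set G) (R : set (rel_free X)) : Prop :=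
  [/\ rel_presentation R, finite_set X & finite_set R].

(* The alphabet: the disjoint union of X and of the sets H l minus 1. *)
Definition letter (X : set G) : Type := (X + {l : L & {h : H l | h != 1}})%type.

Definition letter_elt (X : set G) (a : letter X) : rel_free X :=
  match a with
  | inl x => pres_gen _ (inr x)
  | inr (existT l h) => pres_gen _ (inl (existT _ l (val h)))
  end.

Definition word_elt (X : set G) (W : seq (letter X)) : rel_free X :=
  \prod_(a <- W) letter_elt a.

Definition conj_product (X : set G) (R : set (rel_free X)) (k : nat)
    (w : rel_free X) : Prop :=
  exists (f r : 'I_k -> rel_free X) (e : 'I_k -> bool),
    (forall i, R (r i)) /\
    w = \prod_(i < k) ((f i)^-1 * (if e i then (r i)^-1 else r i) * f i).

Definition is_rel_area (X : set G) (R : set (rel_free X)) (W : seq (letter X))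
    (k : nat) : Prop :=
  conj_product R k (word_elt W) /\
  forall j, conj_product R j (word_elt W) -> (k <= j)%N.

Definition bounds_rel_area (X : set G) (R : set (rel_free X))
    (f : nat -> nat) : Prop :=
  forall n (W : seq (letter X)), (size W <= n)%N ->
    rel_proj (word_elt W) = 1 -> exists2 k, is_rel_area R W k & (k <= f n)%N.

Definition is_rel_dehn (X : set G) (R : set (rel_free X))
    (f : nat -> nat) : Prop :=
  bounds_rel_area R f /\
  forall g, bounds_rel_area R g -> forall n, (f n <= g n)%N.

Definition rel_hyperbolic : Prop :=
  exists (X : set G) (R : set (rel_free X)), finite_rel_presentation R /\
  exists f, is_rel_dehn R f /\ exists c, forall n, (f n <= c * n)%N.

End Relative.

(* Main.v *)
(* A word over the peripherals of A and B splits into syllables from the two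
   factors. It is read one letter at a time, keeping an alternating stack of
   syllables outside K, followed by an element of K. When the top syllable v,
   of length m, comes to represent some k in K, the word v k^-1 has area at
   most c (m + 1) in its factor, so v is replaced by the letter k, which is also
   the letter xi k of B_eta, and the stack shrinks by m. The total area spent is
   therefore linear, and by the normal form theorem a word trivial in the
   amalgam ends with an empty stack and k = 1. Linearity of the area in turn
   implies that the relators of A and B normally generate the kernel. *)

Require Import Defs.
From HB Require Import structures.
From mathcomp Require Import all_boot.
From mathcomp Require Import all_classical.
From mathcomp Require Import zify.

Set Implicit Arguments.
Unset Strict Implicit.
Unset Printing Implicit Defensive.

Local Open Scope classical_set_scope.
Local Open Scope group_scope.
Local Open Scope quotient_scope.

(** * Elementary identities for group homomorphisms *)

Section Multiplicative.
Variables (G H : groupType) (f : {multiplicative G -> H}).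

Lemma multiplicative1 : f 1 = 1.
Proof. by apply: (mulgI (f 1)); rewrite -gmulfM !mulg1. Qed.

Lemma multiplicativeV : {morph f : x / x^-1}.
Proof.
by move=> x; apply: (mulgI (f x)); rewrite -gmulfM !mulgV multiplicative1.
Qed.
End Multiplicative.

(** * Normal forms in amalgamated products *)

Definition head_tag (C : bool -> Type) (l : seq {b & C b}) : option bool :=
  ohead [seq tag x | x <- l].

Fixpoint alternating (C : bool -> Type) (P : forall b, C b -> Prop)
    (l : seq {b & C b}) : Prop :=
  if l is x :: l' then
    [/\ P (tag x) (tagged x), head_tag l' <> Some (tag x) & alternating P l']
  else True.

Section NormalForm.
Variables (K : groupType) (C : bool -> groupType).
Variable i : forall b, {multiplicative K -> C b}.
Hypothesis i_inj : forall b, injective (i b).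

(** The choice is made from the whole left coset of c modulo K, so it depends on the coset only. The
    coset contains c, so the default 1 is never returned. The representative of K itself may differ
    from 1, which is why [push] treats the elements of K apart. *)
Definition coset_rep b (c : C b) : C b :=
  xget 1 [set t | exists k, c = t * i b k].

Definition coset_part b (c t : C b) : K := xget 1 [set k | c = t * i b k].

Lemma coset_part_eq b (t : C b) k : coset_part (t * i b k) t = k.
Proof. by apply: xget_unique => // k' /mulgI/i_inj. Qed.

Lemma coset_repK b (c : C b) :
  c = coset_rep c * i b (coset_part c (coset_rep c)).
Proof.
have [k ck] : exists k, c = coset_rep c * i b k.
  apply: (@xgetPex _ 1 [set t | exists k, c = t * i b k]).
  by exists c; exists 1; rewrite multiplicative1 mulg1.
exact: (@xgetPex _ 1 [set k | c = coset_rep c * i b k] (ex_intro _ k ck)).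
Qed.

Lemma coset_repM b (c : C b) k : coset_rep (c * i b k) = coset_rep c.
Proof.
congr (xget 1 _); apply/seteqP; split=> t /= [k' e].
  by exists (k' / k); rewrite gmulfM multiplicativeV mulgA -e mulgK.
by exists (k' * k); rewrite gmulfM mulgA -e.
Qed.

Lemma range_mulr b (c : C b) k : range (i b) (c * i b k) <-> range (i b) c.
Proof.
split=> [[k' _ e]|[k' _ <-]]; last by exists (k' * k); rewrite ?gmulfM.
by exists (k' / k) => //; rewrite gmulfM multiplicativeV e mulgK.
Qed.

(* The state ([:: t_1; ...; t_n], k) stands for the normal form
   t_n ... t_1 k. *)
Definition nf_state := (seq {b & C b} * K)%type.

Definition nf (st : nf_state) : Prop :=
  alternating (fun b (t : C b) => ~ range (i b) t /\ coset_rep t = t) st.1.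

(** Matching on both booleans gives the syllable the type [C b] without a transport along an
    equality of tags. *)
Definition untag_at b (x : {b & C b}) : option (C b) :=
  let: existT b' t := x in
  match b', b return C b' -> option (C b) with
  | true, true | false, false => fun t => Some t
  | _, _ => fun=> None
  end t.
Arguments untag_at : simpl never.

Variant untag_at_spec b (x : {b & C b}) : option (C b) -> Prop :=
| UntagSame t of x = existT _ b t : untag_at_spec x (Some t)
| UntagDiff of tag x <> b : untag_at_spec x None.

Lemma untag_atP b (x : {b & C b}) : untag_at_spec x (untag_at b x).
Proof. by case: x => b' t; case: b' t; case: b => t /=; constructor. Qed.

(** [pull b] writes a normal form as a stack not topped by a syllable of [C b], followed by an
    element of [C b]; [push] is the inverse. In these coordinates [nf_act] is right multiplication,
    so the action laws need no case analysis on cancellation. *)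
Definition pull b (st : nf_state) : seq {b & C b} * C b :=
  if st.1 is x :: l then
    if untag_at b x is Some t then (l, t * i b st.2) else (st.1, i b st.2)
  else (st.1, i b st.2).

Definition push b (st : seq {b & C b} * C b) : nf_state :=
  if `[< range (i b) st.2 >] then (st.1, coset_part st.2 1)
  else (existT _ b (coset_rep st.2) :: st.1, coset_part st.2 (coset_rep st.2)).

Definition nf_act b (c : C b) (st : nf_state) : nf_state :=
  push ((pull b st).1, (pull b st).2 * c).

Lemma push_range b l k : push (l, i b k) = (l, k).
Proof.
rewrite /push asboolT /=; last by exists k.
by rewrite -[i b k]mul1g coset_part_eq.
Qed.

Lemma push_coset b l (t : C b) k : ~ range (i b) t -> coset_rep t = t ->
  push (l, t * i b k) = (existT _ b t :: l, k).
Proof.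
move=> tK rt; rewrite /push asboolF /=; last by move/range_mulr.
by rewrite coset_repM rt coset_part_eq.
Qed.

Lemma push_pull b st : nf st -> push (pull b st) = st.
Proof.
case: st => -[|x l] k; first by rewrite push_range.
rewrite /pull /nf /=; case: untag_atP => [t ->|_] /= [].
  by case=> tK rt _ _; rewrite push_coset.
by rewrite push_range.
Qed.

Lemma head_pull b st : nf st -> head_tag (pull b st).1 <> Some b.
Proof.
case: st => -[|x l] k //; rewrite /pull /nf /=.
by case: untag_atP => [t ->|xb] [] //= _ _ _ [].
Qed.

Lemma alternating_pull b st : nf st -> nf ((pull b st).1, 1).
Proof.
by case: st => -[|x l] k //; rewrite /pull /nf /=; case: untag_atP => [t _ []|].
Qed.

Lemma nf_push b l (c : C b) k : nf (l, k) -> head_tag l <> Some b ->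
  nf (push (l, c)).
Proof.
move=> nfl lb; rewrite /push; case: asboolP => //= cK; split=> //=.
split; first by move=> rK; apply: cK; rewrite [c]coset_repK; apply/range_mulr.
by rewrite -[LHS](coset_repM _ (coset_part c (coset_rep c))) -coset_repK.
Qed.

Lemma pull_push b l (c : C b) : head_tag l <> Some b ->
  pull b (push (l, c)) = (l, c).
Proof.
move=> lb; rewrite /push; case: asboolP => /= [[k _ <-]|_].
  rewrite -[i b k]mul1g coset_part_eq mul1g.
  by case: l lb => [|x l] //=; rewrite /pull /=; case: untag_atP => [t -> []|].
rewrite /pull /=; case: untag_atP => //= t e.
by rewrite -(eq_from_Tagged e) -coset_repK.
Qed.

Lemma nf_act_nf b (c : C b) st : nf st -> nf (nf_act c st).
Proof.
by move=> nfst; apply: nf_push (alternating_pull b nfst) (@head_pull b _ nfst).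
Qed.

Lemma nf_actM b (c d : C b) st : nf st ->
  nf_act (c * d) st = nf_act d (nf_act c st).
Proof.
by move=> nfst; rewrite /nf_act pull_push ?mulgA //=; apply: head_pull.
Qed.

Lemma nf_act1 b st : nf st -> nf_act (1 : C b) st = st.
Proof. by move=> nfst; rewrite /nf_act mulg1 -surjective_pairing push_pull. Qed.

Lemma nf_actK b k st : nf st -> nf_act (i b k) st = (st.1, st.2 * k).
Proof.
case: st => l k'; move=> nfst; rewrite /nf_act.
have -> : ((pull b (l, k')).1, (pull b (l, k')).2 * i b k) = pull b (l, k' * k).
  case: l {nfst} => [|x l] /=; rewrite /pull /= ?gmulfM //.
  by case: untag_atP => * //; rewrite mulgA.
by rewrite push_pull.
Qed.

(** Only tags are tracked: the syllables are replaced by coset representatives, but the tags already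
    determine the length and the alternation. *)
Lemma nf_act_tags b (c : C b) st : ~ range (i b) c -> head_tag st.1 <> Some b ->
  [seq tag x | x <- (nf_act c st).1] = b :: [seq tag x | x <- st.1].
Proof.
move=> cK stb; rewrite /nf_act.
have -> : pull b st = (st.1, i b st.2).
  case: st stb => -[|x l] k //=; rewrite /pull /=.
  by case: untag_atP => [t -> []|].
rewrite /push asboolF //= => -[k _ e].
apply: cK; exists (st.2^-1 * k) => //.
by rewrite gmulfM multiplicativeV e mulKg.
Qed.

End NormalForm.
Arguments nf_act {K C} i b c st.

Section AmalgamNormalForm.
Variables (A B : groupType) (K : subgroup A) (H : subgroup B).
Variable xi : {multiplicative K -> H}.
Hypothesis xi_inj : injective xi.

(** A family over the booleans gives the syllables of both factors a common type and lets each
    argument treat both factors at once. *)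
Definition factor (b : bool) : groupType := if b then A else B.

Definition base_incl b : {multiplicative K -> factor b} :=
  match b return {multiplicative K -> factor b} with
  | true => (val : {multiplicative K -> A})
  | false => (val \o xi : {multiplicative K -> B})
  end.

Definition factor_incl b : {multiplicative factor b -> amalgam xi} :=
  match b return {multiplicative factor b -> amalgam xi} with
  | true => amalgam_inl xi
  | false => amalgam_inr xi
  end.

Lemma base_incl_inj b : injective (base_incl b).
Proof. by case: b => x y; [apply: val_inj | move/val_inj/xi_inj]. Qed.

Notation state := (nf_state K factor).
Notation act := (nf_act base_incl).
Notation isnf := (nf base_incl).

Definition letter_act (st : state) (a : {classic A + B} * bool) : state :=
  match (a.1 : A + B) with
  | inl x => act true (if a.2 then x^-1 else x) st
  | inr y => act false (if a.2 then y^-1 else y) st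
  end.

Definition word_act (w : word (A + B)) (st : state) : state :=
  foldl letter_act st w.

Lemma word_act_nf w st : isnf st -> isnf (word_act w st).
Proof.
elim: w st => //= -[[x|y] e] w IH st nfst; apply: IH;
  exact: nf_act_nf.
Qed.

(** The multiplication tables are respected by the action law on normal forms, and the gluing
    relation because either copy of k only multiplies the K-component. Hence the amalgam acts on the
    right on normal forms. *)
Lemma word_act_eq u v st : pres_eq (amalgam_rel xi) u v -> isnf st ->
  word_act u st = word_act v st.
Proof.
move=> uv; elim: uv st => {u v}
    [//|u v _ IH st nfst|u v w _ IHu _ IHv st nfst|u u' v v' _ IHu _ IHv st nfst
    |s b st nfst|u v [x y|x y|k] st nfst].
- by rewrite IH.
- by rewrite IHu ?IHv.
- rewrite /word_act !foldl_cat -!/(word_act _ _) IHu // IHv //.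
  exact: word_act_nf.
- case: s => [x|y]; rewrite /word_act /= /letter_act /=;
    rewrite -(nf_actM base_incl_inj) //; case: b => /=;
    by rewrite ?mulgV ?mulVg (nf_act1 base_incl_inj _ nfst).
- by rewrite /word_act /= /letter_act /= -(nf_actM base_incl_inj).
- by rewrite /word_act /= /letter_act /= -(nf_actM base_incl_inj).
- rewrite /word_act /= /letter_act /=.
  by rewrite (nf_actK base_incl_inj true k) // (nf_actK base_incl_inj false k).
Qed.

Definition amalgam_act (g : amalgam xi) (st : state) : state :=
  word_act (repr g) st.

Lemma amalgam_actM g h st : isnf st ->
  amalgam_act (g * h) st = amalgam_act h (amalgam_act g st).
Proof.
move=> nfst; rewrite /amalgam_act (word_act_eq (repr_pres _ _) nfst).
by rewrite /word_act foldl_cat.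
Qed.

Lemma amalgam_act_incl b (c : factor b) st : isnf st ->
  amalgam_act (factor_incl b c) st = act b c st.
Proof.
move=> nfst; case: b c => c;
  by rewrite /amalgam_act (word_act_eq (repr_pres _ _) nfst).
Qed.

(** The head of the list is the top of the stack, hence the rightmost factor. *)
Definition stack_prod (s : seq {b & factor b}) : amalgam xi :=
  foldr (fun x g => g * factor_incl (tag x) (tagged x)) 1 s.

(* Acting on the empty normal form, each syllable outside the base adds one
   entry to the stack. *)
Lemma amalgam_normal_form (s : seq {b & factor b}) (k : K) :
  alternating (fun b c => ~ range (base_incl b) c) s ->
  stack_prod s * amalgam_inl xi (val k) = 1 -> s = [::] /\ k = 1.
Proof.
move=> alt; have nf0 : isnf ([::], 1) by [].
have [tags nfs] : [seq tag x | x <- (amalgam_act (stack_prod s) ([::], 1)).1]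
    = [seq tag x | x <- s] /\ isnf (amalgam_act (stack_prod s) ([::], 1)).
  elim: s alt => [_|x s IH] /=.
    by rewrite /amalgam_act (word_act_eq (repr_pres _ _) nf0).
  case=> xK sx /IH[tags nfs]; rewrite amalgam_actM // amalgam_act_incl //.
  split; last exact: nf_act_nf.
  rewrite nf_act_tags ?tags //.
  by rewrite /head_tag tags.
(* The element k changes only the K-component, so the stack obtained from the whole product still
   has the tags of s. The identity leaves it empty, which forces s to be empty, and then the
   K-components give k = 1. *)
move=> /(congr1 (fun g => amalgam_act g ([::], 1))).
rewrite amalgam_actM // (amalgam_act_incl (b := true)) //.
rewrite (nf_actK base_incl_inj true k) //.
rewrite [RHS](word_act_eq (repr_pres _ _) nf0) /= => e.
have e1 := congr1 fst e; have e2 := congr1 snd e; rewrite /= in e1 e2.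
have s0 : s = [::] by move: tags; rewrite e1; case: (s).
move: e2; rewrite s0 /= /amalgam_act (word_act_eq (repr_pres _ _) nf0) /= mul1g.
by split.
Qed.

End AmalgamNormalForm.

(** * Reducing words over the two factors *)

Section StackReduction.
Variables (A B : groupType) (K : subgroup A) (H : subgroup B).
Variable xi : {multiplicative K -> H}.
Hypothesis xi_inj : injective xi.

(** Here [F b] stands for the free product mapping onto the factor b, and E for the one mapping onto
    the amalgam, with projections [p] and [q]. The map [kap] is the copy of K in [F b], and [phi]
    carries both copies to the same elements of E. The predicates [short] and [area] bound word
    lengths and areas from above. *)
Variables (F : bool -> groupType) (E : groupType) (L : Type).
Variable p : forall b, {multiplicative F b -> factor A B b}.
Variable kap : forall b, {multiplicative K -> F b}.
Variable phi : forall b, {multiplicative F b -> E}.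
Variable q : {multiplicative E -> amalgam xi}.
Variables (short : forall b, nat -> F b -> Prop) (area : nat -> E -> Prop).
Variable c : nat.
Variable letter_of : L -> {b & F b}.
Arguments short : clear implicits.

Hypothesis p_kap : forall b k, p b (kap b k) = base_incl xi b k.
Hypothesis phi_kap : forall b k, phi b (kap b k) = phi true (kap true k).
Hypothesis q_phi : forall b x, q (phi b x) = factor_incl xi b (p b x).
Hypothesis shortM : forall b m n x y,
  short b m x -> short b n y -> short b (m + n) (x * y).
Hypothesis short_kap : forall b k, short b 1 (kap b k).
Hypothesis area1 : area 0 1.
Hypothesis areaM : forall m n x y,
  area m x -> area n y -> area (m + n) (x * y).
Hypothesis areaJ : forall m x y, area m x -> area m (x ^ y).
Hypothesis area_leq : forall m n x, (m <= n)%N -> area m x -> area n x.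
Hypothesis area_ker : forall m x, area m x -> q x = 1.
Hypothesis short_area : forall b m x,
  short b m x -> p b x = 1 -> area (c * m) (phi b x).
Hypothesis short_letter :
  forall a, short (tag (letter_of a)) 1 (tagged (letter_of a)).

(** The empty stack admits every m, so m is an upper bound on the total length of the syllables. *)
Fixpoint sized_stack (s : seq {b & F b}) (m : nat) : Prop :=
  if s is x :: s' then
    exists m1 m2, [/\ m = (m1 + m2)%N, short (tag x) m1 (tagged x)
                    & sized_stack s' m2]
  else True.

Definition phi_prod (s : seq {b & F b}) : E :=
  foldr (fun x g => g * phi (tag x) (tagged x)) 1 s.

(** The word v k^-1 is one letter longer than v and trivial in its factor; its image is z. *)
Lemma pop_base b m v k : short b m v -> p b v = base_incl xi b k ->
  exists2 z, area (c * (m + 1)) z & phi b v = z * phi true (kap true k).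
Proof.
move=> vm pv; exists (phi b (v * kap b k^-1)).
  apply: short_area; first exact: shortM.
  by rewrite gmulfM p_kap pv -gmulfM mulgV multiplicative1.
by rewrite -(phi_kap b) -gmulfM -mulgA -gmulfM mulVg multiplicative1 mulg1.
Qed.

(* The total a + c * m, of the area spent and the cost of eventually popping
   the stack, grows by at most 3 * c with each letter read. *)
Lemma stack_reduction (w : seq L) : exists s k m a y,
  [/\ alternating (fun b x => ~ range (base_incl xi b) (p b x)) s,
      sized_stack s m, area a y, (a + c * m <= 3 * c * size w)%N
    & \prod_(l <- w) phi _ (tagged (letter_of l)) =
        y * phi_prod s * phi true (kap true k)].
Proof.
elim/last_ind: w => [|w l [s [k [m [a [y [alt szs ay le_am ep]]]]]]].
  exists [::], 1, 0%N, 0%N, 1; split=> //=; first by rewrite !muln0.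
  by rewrite big_nil !multiplicative1 !mulg1.
rewrite size_rcons.
(* The element k, written as a letter of the factor of l, and the letter l are merged into a
   syllable v, together with the top of the stack when that lies in the same factor. Two letters are
   added, whence m + 2. *)
have [s' [m' [b [v [m1 [alt' sb szs' [vm1 le_m] e]]]]]] :
  exists s' m' b v m1,
    [/\ alternating (fun b x => ~ range (base_incl xi b) (p b x)) s',
        head_tag s' <> Some b, sized_stack s' m',
        short b m1 v /\ (m1 + m' <= m + 2)%N &
        phi_prod s * phi true (kap true k) * phi _ (tagged (letter_of l)) =
        phi_prod s' * phi b v].
  move: (letter_of l) (short_letter l) => [b x] /= x1.
  rewrite -(phi_kap b).
  have [sb|sb] := pselect (head_tag s = Some b); last first.
    exists s, m, b, (kap b k * x), 2%N; split=> //.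
    - by split; [apply: (@shortM b 1 1) | rewrite addnC].
    - by rewrite gmulfM mulgA.
  case: s {ep} alt szs sb => [//|[b' t] s] [_ sb' alt].
  move=> [m1 [m2 [-> tm1 szs]]] [bb'].
  move: t sb' tm1; rewrite bb' => /= t sb tm1.
  exists s, m2, b, (t * (kap b k * x)), (m1 + 2)%N; split=> //.
  - by split; [apply: shortM => //; apply: (@shortM b 1 1) | rewrite addnAC].
  - by rewrite !gmulfM !mulgA.
have {}e : \prod_(l' <- rcons w l) phi _ (tagged (letter_of l')) =
    y * phi_prod s' * phi b v.
  by rewrite -cats1 big_cat big_seq1 /= ep -mulgA -[RHS]mulgA -e !mulgA.
(* If v lies outside K it is pushed and the K-component becomes 1; no area is spent and the total
   grows by at most 2 * c. *)
have [[k' _ pk]|vK] := pselect (range (base_incl xi b) (p b v)); last first.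
  exists (existT _ b v :: s'), 1, (m1 + m')%N, a, y.
  split=> //=; first by exists m1, m'.
    nia.
  by rewrite e !multiplicative1 mulg1 mulgA.
(* If v represents an element of K it is popped. The letter k^-1 in [pop_base] adds one more c,
   which accounts for the constant 3. The element z is moved to the left of the remaining stack by
   conjugation, which preserves areas. *)
have [z az ez] := pop_base vm1 (esym pk).
exists s', k', m', (a + c * (m1 + 1))%N, (y * z ^ (phi_prod s')^-1).
split=> //.
- by apply: areaM => //; apply: areaJ.
- nia.
- by rewrite e ez conjgE invgK !mulgA mulgVK.
Qed.

Lemma stack_prodE s : q (phi_prod s) =
  stack_prod xi [seq existT _ (tag x) (p (tag x) (tagged x)) | x <- s].
Proof.
elim: s => [|x s IH] /=; first exact: multiplicative1.
by rewrite gmulfM IH q_phi.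
Qed.

(** Having an area, y dies in the amalgam, so the remaining stack and k have trivial product there.
    By the normal form theorem they vanish, and the word equals y. *)
Lemma word_area (w : seq L) :
  q (\prod_(l <- w) phi _ (tagged (letter_of l))) = 1 ->
  area (3 * c * size w) (\prod_(l <- w) phi _ (tagged (letter_of l))).
Proof.
have [s [k [m [a [y [alt szs ay le_am ->]]]]]] := stack_reduction w.
rewrite !gmulfM (area_ker ay) mul1g q_phi p_kap stack_prodE.
move/(amalgam_normal_form xi_inj) => [|s0 ->].
  elim: s alt {szs} => //= x s IH [xK xs /IH alt]; split=> //.
  by move: xs; rewrite /head_tag -map_comp.
have -> : s = [::] by case: s s0 {alt szs}.
rewrite !multiplicative1 !mulg1; apply: area_leq ay.
by apply: leq_trans le_am; rewrite leq_addr.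
Qed.

End StackReduction.

Lemma pi_word_eval (S : Type) (rel : word S -> word S -> Prop) (u : word S) :
  \pi_(presented rel) u = word_eval (pres_gen rel) u :> presented rel.
Proof.
elim: u => [|[s e] u IH]; first by rewrite /word_eval big_nil.
rewrite /word_eval big_cons -/(word_eval _ _) -IH -cat1s -pi_mul.
congr (_ * _); case: e => //=; apply/esym/mulg1_eq.
by rewrite [LHS]pi_mul; apply/presented_eq/pres_cancel.
Qed.

(** * Relative areas *)

Section Normal.
Variables (G : groupType) (N : set G).
Hypothesis nN : is_normal N.

Lemma normal_in1 : N 1.
Proof. by have [[/set_mem]] := nN. Qed.

Lemma normal_inV x : N x -> N x^-1.
Proof.
have [[N1 ND] _] := nN; move=> Nx; rewrite -[x^-1]mul1g.
by apply/set_mem/ND => //; apply/mem_set.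
Qed.

Lemma normal_inM x y : N x -> N y -> N (x * y).
Proof.
have [[N1 ND] _] := nN; move=> Nx Ny; rewrite -[y]invgK.
by apply/set_mem/ND; apply/mem_set => //; apply: normal_inV.
Qed.

Lemma normal_inJ x y : N x -> N (x ^ y).
Proof. by have [_] := nN; apply. Qed.
End Normal.

Section ConjProduct.
Variables (G : groupType) (L : Type) (H : L -> subgroup G) (X : set G).
Implicit Types (R : set (rel_free H X)) (w : rel_free H X).

(** Unlike [conj_product], which counts exactly k conjugates, this is monotone in k. *)
Definition area_le R (k : nat) w : Prop :=
  exists2 j, (j <= k)%N & conj_product R j w.

Lemma area_le1 R : area_le R 0 1.
Proof.
exists 0%N => //; exists (fun=> 1), (fun=> 1), xpredT.
by split=> [[]|] //; rewrite big_ord0.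
Qed.

Lemma area_le_trans R m n w : (m <= n)%N -> area_le R m w -> area_le R n w.
Proof. by move=> mn [j jm Rw]; exists j => //; apply: leq_trans mn. Qed.

Lemma area_leM R m n v w :
  area_le R m v -> area_le R n w -> area_le R (m + n) (v * w).
Proof.
move=> [j jm [f [r [e [Rr ->]]]]] [j' jn [f' [r' [e' [Rr' ->]]]]].
exists (j + j')%N; first exact: leq_add.
pose glue T (a : 'I_j -> T) (a' : 'I_j' -> T) (i : 'I_(j + j')) :=
  match fintype.split i with inl i1 => a i1 | inr i2 => a' i2 end.
exists (glue _ f f'), (glue _ r r'), (glue _ e e'); split.
  by move=> i; rewrite /glue; case: fintype.split.
rewrite big_split_ord /glue; congr (_ * _); apply: eq_bigr => i _.
  by rewrite (unsplitK (inl i)).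
by rewrite (unsplitK (inr i)).
Qed.

Lemma area_leJ R m v w : area_le R m v -> area_le R m (v ^ w).
Proof.
move=> [j jm [f [r [e [Rr ->]]]]]; exists j => //.
exists (fun i => f i * w), r, e; split=> //.
rewrite conjg_prod; apply: eq_bigr => i _.
by rewrite conjgE invgM !mulgA.
Qed.

Lemma area_le_normal R (N : set (rel_free H X)) m w :
  is_normal N -> R `<=` N -> area_le R m w -> N w.
Proof.
move=> nN RN [j _ [f [r [e [Rr ->]]]]].
elim/big_ind: _ => [||i _]; first exact: normal_in1.
  exact: normal_inM.
rewrite -mulgA; apply: normal_inJ => //.
by case: (e i); [apply: normal_inV|]; rewrite //; apply: RN.
Qed.

Lemma normal_closure_normal R : is_normal (normal_closure R).
Proof.
split; first split.
- by apply/mem_set => N [[[/set_mem N1 _] _] _].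
- move=> x y /set_mem Rx /set_mem Ry; apply/mem_set => N [nN RN].
  have [[_ ND] _] := nN.
  by apply/set_mem/ND; apply/mem_set; [apply: Rx|apply: Ry].
- by move=> x y Rx N [nN RN]; have [_ NJ] := nN; apply: NJ; apply: Rx.
Qed.

HB.instance Definition _ :=
  isMultiplicative.Build (rel_free H X) G
    (@rel_proj G L H X) (@rel_projM G L H X).

Lemma rel_proj_ker_normal : is_normal [set w : rel_free H X | rel_proj w = 1].
Proof.
split; first split.
- by apply/mem_set; rewrite /= multiplicative1.
- move=> x y /set_mem /= x1 /set_mem /= y1; apply/mem_set => /=.
  by rewrite gmulfM multiplicativeV /= x1 y1 invg1 mulg1.
- move=> x y /= x1; rewrite conjgE !gmulfM /= x1 mul1g -gmulfM mulVg.
  exact: multiplicative1.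
Qed.

Definition linear_area R (c : nat) : Prop :=
  forall W : seq (letter H X), rel_proj (word_elt W) = 1 ->
    area_le R (c * size W) (word_elt W).

Definition word_short (m : nat) w : Prop :=
  exists2 W : seq (letter H X), (size W <= m)%N & word_elt W = w.

Lemma word_shortM m n v w :
  word_short m v -> word_short n w -> word_short (m + n) (v * w).
Proof.
move=> [V Vm <-] [W Wn <-]; exists (V ++ W); last exact: big_cat.
by rewrite size_cat leq_add.
Qed.

Lemma word_short_letter (a : letter H X) : word_short 1 (letter_elt a).
Proof. by exists [:: a]; rewrite // /word_elt big_seq1. Qed.

Lemma word_short_area R c m w : linear_area R c -> word_short m w ->
  rel_proj w = 1 -> area_le R (c * m) w.
Proof.
move=> Rc [W Wm <-] /Rc; apply: area_le_trans.
by rewrite leq_mul.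
Qed.

Definition rel_sub l (h : H l) : rel_free H X :=
  pres_gen (@rel_free_rel G L H X) (inl (existT _ l h)).

Lemma rel_subM l : {morph @rel_sub l : x y / x * y}.
Proof.
move=> x y; apply/esym; rewrite [LHS](@pi_mul _ (@rel_free_rel G L H X)).
by apply/presented_eq/pres_rel; constructor.
Qed.

HB.instance Definition _ l :=
  isMultiplicative.Build (H l) (rel_free H X) (@rel_sub l) (@rel_subM l).

(** The alphabet omits the identity of [H l], which is given by the empty word instead. *)
Lemma word_short_sub l (h : H l) : word_short 1 (rel_sub h).
Proof.
have [->|h1] := eqVneq h 1; last first.
  exact: (word_short_letter (inr (existT _ l (exist _ h h1)))).
by exists [::] => //; rewrite multiplicative1 /word_elt big_nil.
Qed.

(* A word has no letter for the inverse of a free generator x, but [x^-1] is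
   again in X and the word [x^-1] x is trivial in G. *)
Lemma word_elt_modulo R c w : (forall x, X x -> X x^-1) -> linear_area R c ->
  exists W : seq (letter H X), normal_closure R (w / word_elt W).
Proof.
move=> Xsym Rc; have nN := @normal_closure_normal R; set N := normal_closure R.
have step v V v' V' : N (v / word_elt V) -> N (v' / word_elt V') ->
    N (v * v' / word_elt (V ++ V')).
  move=> NV NV'; rewrite [word_elt _]big_cat -!/(word_elt _).
  have -> : v * v' / (word_elt V * word_elt V') =
      (v' / word_elt V') ^ v^-1 * (v / word_elt V).
    by rewrite conjgE invgK invgM !mulgA mulgVK.
  by apply: (normal_inM nN) => //; apply: (normal_inJ nN).
elim/quotW: w => u; rewrite pi_word_eval.
elim: u => [|[s e] u [V' NV']].
  exists [::]; rewrite /word_eval /word_elt !big_nil mulgV.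
  exact: normal_in1 nN.
suff [V NV] : exists V, N ((if e then (pres_gen _ s)^-1 else pres_gen _ s) /
                           word_elt V).
  by exists (V ++ V'); rewrite /word_eval big_cons; apply: step.
case: s => [[l h]|x].
  have [V _ eV] := word_short_sub (if e then h^-1 else h).
  exists V; rewrite eV; case: e {eV}; rewrite ?multiplicativeV mulgV;
    exact: normal_in1 nN.
case: e; last first.
  by exists [:: inl x]; rewrite /word_elt big_seq1 mulgV; apply: normal_in1 nN.
have Xx : (val x)^-1 \in X by apply/mem_set/Xsym/set_mem/valP.
pose x' : X := Sub (val x)^-1 Xx.
exists [:: inl x']; rewrite /word_elt big_seq1 -invgM; apply: (normal_inV nN).
have -> : letter_elt (inl x') * pres_gen _ (inr x) =
    word_elt ([:: inl x'; inl x] : seq (letter H X)).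
  by rewrite /word_elt !big_cons big_nil mulg1.
apply: area_le_normal nN _ (Rc _ _); first exact: sub_gen_smallest.
rewrite /word_elt !big_cons big_nil mulg1 rel_projM !rel_proj_gen /=.
exact: mulVg.
Qed.

(** Modulo the normal closure of R, an element w of the kernel is a word W. Since R dies in G, so
    does W, and its area bound makes it a product of conjugates of relators. *)
Lemma linear_area_normal_closure R c : (forall x, X x -> X x^-1) ->
  R `<=` [set w | rel_proj w = 1] -> linear_area R c ->
  [set w | rel_proj w = 1] = normal_closure R.
Proof.
move=> Xsym Rker Rc; apply/seteqP; split; last first.
  exact: smallest_sub rel_proj_ker_normal Rker.
move=> w /= w1; have [W NW] := word_elt_modulo w Xsym Rc.
rewrite -[w](mulgVK (word_elt W)).
apply: (normal_inM (@normal_closure_normal R)) => //.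
apply: area_le_normal (@normal_closure_normal R) (@sub_gen_smallest _ _ _) (Rc _ _).
have /= := smallest_sub rel_proj_ker_normal Rker NW.
rewrite gmulfM /= w1 mul1g multiplicativeV /= => e.
by rewrite -[LHS]invgK e invg1.
Qed.

End ConjProduct.

(** The value at n is the least bound on the areas of trivial words of length at most n; such bounds
    exist because c * n is one. *)
Lemma linear_area_rel_dehn (G : groupType) (L : Type) (H : L -> subgroup G)
    (X : set G) (R : set (rel_free H X)) c :
  linear_area R c -> exists2 f, is_rel_dehn R f & forall n, (f n <= c * n)%N.
Proof.
move=> Rc.
pose bound n k := `[< forall W j, (size W <= n)%N ->
  rel_proj (word_elt W) = 1 -> is_rel_area R W j -> (j <= k)%N >].
have bound_cn n : bound n (c * n)%N.
  apply/asboolP => W j Wn /Rc[k kc Rk] [_ /(_ k Rk) jk].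
  by apply: leq_trans jk (leq_trans kc _); rewrite leq_mul.
have bound_c n : exists k, bound n k by exists (c * n)%N.
exists (fun n => ex_minn (bound_c n)) => [|n]; last first.
  by case: ex_minnP => k _; apply.
split=> [n W Wn W1|g gR n].
  have exk : exists k, `[< conj_product R k (word_elt W) >].
    by have [k _ Rk] := Rc W W1; exists k; apply/asboolP.
  have [k /asboolP Rk kmin] := find_ex_minn exk.
  have areak : is_rel_area R W k.
    by split=> // j Rj; apply: kmin; apply/asboolP.
  by exists k => //; case: ex_minnP => m /asboolP bm _; apply: bm areak.
case: ex_minnP => m _; apply; apply/asboolP => W j Wn W1 [Rj jmin].
have [k [Rk _] kg] := gR n W Wn W1.
exact: leq_trans (jmin k Rk) kg.
Qed.

(** Reduces the theorem to a linear area bound: the Dehn function and the equality of the kernel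
    with the normal closure are both recovered from it. *)
Lemma rel_hyperbolicP (G : groupType) (L : Type) (H : L -> subgroup G) :
  rel_hyperbolic H <-> exists (X : set G) (R : set (rel_free H X)) c,
    [/\ (forall x, X x -> X x^-1) /\
        generated (X `|` \bigcup_l sg_set (H l)) = setT,
        finite_set X, finite_set R, R `<=` [set w | rel_proj w = 1]
      & linear_area R c].
Proof.
split=> [[X [R [[[Xsym genX kerR] finX finR] [f [[fR _] [c fc]]]]]]|].
  exists X, R, c; split=> //; first by rewrite kerR; apply: sub_gen_smallest.
  move=> W /(fR _ _ (leqnn _))[k [Rk _] kf]; exists k => //.
  exact: leq_trans kf _.
move=> [X [R [c [[Xsym genX] finX finR Rker Rc]]]]; exists X, R; split.
  by split=> //; split=> //; apply: linear_area_normal_closure Rc.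
by have [f fR fc] := linear_area_rel_dehn Rc; exists f; split=> //; exists c.
Qed.

(** * Homomorphisms out of the free product F, and images of areas and subgroups *)

Section RelFreeLift.
Variables (G : groupType) (L : Type) (H : L -> subgroup G) (X : set G).
Variables (E : groupType) (h : forall l, {multiplicative H l -> E}).
Variable g : X -> E.

Definition rel_lift_val (s : {l : L & H l} + X) : E :=
  match s with inl u => h (tag u) (tagged u) | inr x => g x end.

Definition rel_lift : rel_free H X -> E := pres_lift rel_lift_val.

Lemma rel_lift_val_rel u v : rel_free_rel u v ->
  word_eval rel_lift_val u = word_eval rel_lift_val v.
Proof.
by case=> l x y; rewrite /word_eval !big_cons !big_nil /= !mulg1 gmulfM.
Qed.

Lemma rel_liftM : {morph rel_lift : u v / u * v}.
Proof. exact: pres_liftM rel_lift_val_rel. Qed.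

HB.instance Definition _ :=
  isMultiplicative.Build (rel_free H X) E rel_lift rel_liftM.

Lemma rel_lift_sub l (x : H l) : rel_lift (rel_sub X x) = h l x.
Proof. exact: (pres_lift_gen rel_lift_val_rel). Qed.

Lemma rel_lift_gen (x : X) : rel_lift (letter_elt (inl x)) = g x.
Proof. exact: (pres_lift_gen rel_lift_val_rel). Qed.

End RelFreeLift.

Lemma multiplicative_rel_free_eq (G : groupType) (L : Type)
    (H : L -> subgroup G) (X : set G) (E : groupType)
    (f f' : {multiplicative rel_free H X -> E}) :
  (forall l (x : H l), f (rel_sub X x) = f' (rel_sub X x)) ->
  (forall x : X, f (letter_elt (inl x)) = f' (letter_elt (inl x))) ->
  f =1 f'.
Proof.
move=> fsub fgen; elim/quotW=> u; rewrite pi_word_eval.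
elim: u => [|[s e] u IH].
  by rewrite /word_eval big_nil !multiplicative1.
rewrite /word_eval big_cons -/(word_eval _ _) !gmulfM IH; congr (_ * _).
have fs : f (pres_gen _ s) = f' (pres_gen _ s).
  by case: s => [[l x]|x]; [apply: fsub|apply: fgen].
by case: e; rewrite ?multiplicativeV fs.
Qed.

Lemma area_le_image (G G' : groupType) (L L' : Type) (H : L -> subgroup G)
    (H' : L' -> subgroup G') (X : set G) (X' : set G')
    (R : set (rel_free H X)) (R' : set (rel_free H' X'))
    (f : {multiplicative rel_free H X -> rel_free H' X'}) m w :
  f @` R `<=` R' -> area_le R m w -> area_le R' m (f w).
Proof.
move=> fR [j jm [g [r [e [Rr ->]]]]]; exists j => //.
exists (f \o g), (f \o r), e; split.
  by move=> i; apply: fR; exists (r i).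
rewrite (big_morph f (@gmulfM _ _ f) (multiplicative1 f)).
apply: eq_bigr => i _; rewrite !gmulfM multiplicativeV.
by case: (e i); rewrite ?multiplicativeV.
Qed.

Section SubgroupImage.
Variables (G H : groupType) (f : {multiplicative G -> H}) (K : subgroup G).

Definition sg_map (x : K) : sg_image f K :=
  Sub (f (val x)) (mem_set (imageP f (set_mem (valP x)))).

Lemma sg_mapM : {morph sg_map : x y / x * y}.
Proof. by move=> x y; apply: val_inj; rewrite /= !gmulfM. Qed.

HB.instance Definition _ :=
  isMultiplicative.Build K (sg_image f K) sg_map sg_mapM.

Lemma sg_map_surj (y : sg_image f K) : exists x, sg_map x = y.
Proof.
have /set_mem[x Kx fx] := valP y.
by exists (Sub x (mem_set Kx)); apply: val_inj.
Qed.
End SubgroupImage.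

Lemma generated_subgroup (G : groupType) (S : set G) :
  is_subgroup (generated S).
Proof.
split; first by apply/mem_set => N [[/set_mem]].
move=> x y /set_mem Sx /set_mem Sy; apply/mem_set => N [nN SN].
by have [_ ND] := nN; apply/set_mem/ND; apply/mem_set; [apply: Sx|apply: Sy].
Qed.

Lemma generated_preimage (G H : groupType) (f : {multiplicative G -> H})
    (S : set G) (N : set H) :
  is_subgroup N -> generated S = setT -> (forall x, S x -> N (f x)) ->
  forall x, N (f x).
Proof.
move=> [N1 ND] genS SN x; have : generated S x by rewrite genS.
apply: (@smallest_sub _ _ S [set x | N (f x)]) => //; split.
  by apply/mem_set; rewrite /= multiplicative1; apply/set_mem.
move=> y z /set_mem /= Ny /set_mem /= Nz; apply/mem_set => /=.
by rewrite gmulfM multiplicativeV; apply/set_mem/ND; apply/mem_set.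
Qed.

(** * The relative presentation of the amalgam *)

Section Amalgam.
Variables (A B : groupType) (M N : Type).
Variables (A_ : M -> subgroup A) (K : subgroup A) (B_ : N -> subgroup B).
Variables (eta : N) (xi : {multiplicative K -> B_ eta}).

Definition peripheral_A (i : option M) : subgroup A :=
  if i is Some mu then A_ mu else K.

Definition peripheral_amalgam (i : M + N) : subgroup (amalgam xi) :=
  match i with
  | inl mu => sg_image (amalgam_inl xi) (A_ mu)
  | inr nu => sg_image (amalgam_inr xi) (B_ nu)
  end.

Variables (XA : set A) (XB : set B).

Definition amalgam_gens : set (amalgam xi) :=
  amalgam_inl xi @` XA `|` amalgam_inr xi @` XB.

Notation E := (rel_free peripheral_amalgam amalgam_gens).

Definition gen_inl (x : XA) : amalgam_gens :=
  Sub (amalgam_inl xi (val x))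
    (mem_set (or_introl (imageP _ (set_mem (valP x))))).

Definition gen_inr (y : XB) : amalgam_gens :=
  Sub (amalgam_inr xi (val y))
    (mem_set (or_intror (imageP _ (set_mem (valP y))))).

Definition sub_inl mu : {multiplicative A_ mu -> E} :=
  rel_sub amalgam_gens (H := peripheral_amalgam) (l := inl mu)
    \o @sg_map _ _ (amalgam_inl xi) (A_ mu).

Definition sub_inr nu : {multiplicative B_ nu -> E} :=
  rel_sub amalgam_gens (H := peripheral_amalgam) (l := inr nu)
    \o @sg_map _ _ (amalgam_inr xi) (B_ nu).

(** K is not among the peripherals of the amalgam, so its letters are rewritten as letters of
    [B_ eta]. This makes the two copies of K agree in E. *)
Definition sub_A i : {multiplicative peripheral_A i -> E} :=
  match i return {multiplicative peripheral_A i -> E} with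
  | Some mu => sub_inl mu
  | None => sub_inr eta \o xi
  end.

Definition free_inl : {multiplicative rel_free peripheral_A XA -> E} :=
  rel_lift sub_A (fun x => letter_elt (inl (gen_inl x))).

Definition free_inr : {multiplicative rel_free B_ XB -> E} :=
  rel_lift sub_inr (fun y => letter_elt (inl (gen_inr y))).

(** Two homomorphisms are compared on generators; on the letters of K the equality is the gluing
    relation. *)
Lemma rel_proj_free_inl w : rel_proj (free_inl w) = amalgam_inl xi (rel_proj w).
Proof.
apply: (@multiplicative_rel_free_eq _ _ _ _ _
  (@rel_proj _ _ _ _ \o free_inl) (amalgam_inl xi \o @rel_proj _ _ _ _)).
  move=> l x /=; rewrite rel_lift_sub rel_proj_gen /=.
  case: l x => [mu|] x; rewrite [LHS]rel_proj_gen //=.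
  exact/esym/amalgam_glueE.
by move=> x /=; rewrite rel_lift_gen !rel_proj_gen.
Qed.

Lemma rel_proj_free_inr w : rel_proj (free_inr w) = amalgam_inr xi (rel_proj w).
Proof.
apply: (@multiplicative_rel_free_eq _ _ _ _ _
  (@rel_proj _ _ _ _ \o free_inr) (amalgam_inr xi \o @rel_proj _ _ _ _)).
  by move=> l x /=; rewrite rel_lift_sub !rel_proj_gen.
by move=> x /=; rewrite rel_lift_gen !rel_proj_gen.
Qed.

Definition free_factor (b : bool) : groupType :=
  if b then rel_free peripheral_A XA else rel_free B_ XB.

Definition free_proj b : {multiplicative free_factor b -> factor A B b} :=
  match b return {multiplicative free_factor b -> factor A B b} with
  | true =>
      (@rel_proj _ _ _ XA : {multiplicative rel_free peripheral_A XA -> A})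
  | false => (@rel_proj _ _ _ XB : {multiplicative rel_free B_ XB -> B})
  end.

Definition free_base b : {multiplicative K -> free_factor b} :=
  match b return {multiplicative K -> free_factor b} with
  | true => (@rel_sub _ _ peripheral_A XA None
      : {multiplicative peripheral_A None -> rel_free peripheral_A XA})
  | false => (@rel_sub _ _ B_ XB eta \o xi
      : {multiplicative K -> rel_free B_ XB})
  end.

Definition free_incl b : {multiplicative free_factor b -> E} :=
  match b return {multiplicative free_factor b -> E} with
  | true => free_inl
  | false => free_inr
  end.

Definition factor_short b (m : nat) : free_factor b -> Prop :=
  match b return free_factor b -> Prop with
  | true => word_short m
  | false => word_short m
  end.

(** Lets a word of the amalgam be read letter by letter in the factors without a gain in length. A
    generator may lie in the images of both [XA] and [XB]; either lift serves. *)
Lemma letter_from_factor (a : letter peripheral_amalgam amalgam_gens) :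
  exists x : {b & free_factor b},
    letter_elt a = free_incl (tag x) (tagged x) /\
    @factor_short (tag x) 1 (tagged x).
Proof.
case: a => [x|[[mu|nu] [h h1]]].
- have /set_mem[[y yX e]|[y yX e]] := valP x.
    exists (existT _ true (letter_elt (inl (Sub y (mem_set yX) : XA)))).
    split; last exact: word_short_letter.
    by rewrite /= rel_lift_gen; congr (letter_elt (inl _)); apply: val_inj.
  exists (existT _ false (letter_elt (inl (Sub y (mem_set yX) : XB)))).
  split; last exact: word_short_letter.
  by rewrite /= rel_lift_gen; congr (letter_elt (inl _)); apply: val_inj.
- have [a ea] := sg_map_surj h.
  exists (existT _ true (@rel_sub _ _ peripheral_A XA (Some mu) a)).
  split; last exact: word_short_sub.
  by rewrite /= rel_lift_sub /= ea.
- have [b eb] := sg_map_surj h.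
  exists (existT _ false (@rel_sub _ _ B_ XB nu b)).
  split; last exact: word_short_sub.
  by rewrite /= rel_lift_sub /= eb.
Qed.

Lemma linear_area_amalgam (RA : set (rel_free peripheral_A XA))
    (RB : set (rel_free B_ XB)) c :
  injective xi ->
  RA `<=` [set w | rel_proj w = 1] -> RB `<=` [set w | rel_proj w = 1] ->
  linear_area RA c -> linear_area RB c ->
  linear_area (free_inl @` RA `|` free_inr @` RB) (3 * c).
Proof.
move=> xi_inj kerA kerB areaA areaB W.
have [letter_of letter_ofP] := choice letter_from_factor.
have -> : word_elt W = \prod_(a <- W) free_incl _ (tagged (letter_of a)).
  by apply: eq_bigr => a _; have [] := letter_ofP a.
set R := _ `|` _.
apply: (word_area xi_inj (F := free_factor) (p := free_proj)
  (kap := free_base) (short := factor_short)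
  (q := @rel_proj _ _ peripheral_amalgam amalgam_gens) (area := area_le R)).
- by case=> k; rewrite /= rel_proj_gen.
- by case=> k //=; rewrite !rel_lift_sub.
- by case=> x; rewrite /= ?rel_proj_free_inl ?rel_proj_free_inr.
- by case=> m n x y; apply: word_shortM.
- by case=> k; apply: word_short_sub.
- exact: area_le1.
- by move=> m n x y; apply: area_leM.
- by move=> m x y; apply: area_leJ.
- by move=> m n x; apply: area_le_trans.
- move=> m x; apply: area_le_normal (@rel_proj_ker_normal _ _ _ _) _.
  by move=> _ [[w Rw <-]|[w Rw <-]];
    rewrite /= ?rel_proj_free_inl ?rel_proj_free_inr ?kerA ?kerB
      ?multiplicative1.
- case=> m x xm x1.
    apply: area_le_image (word_short_area areaA xm x1).
    by move=> w Rw; left.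
  apply: area_le_image (word_short_area areaB xm x1).
  by move=> w Rw; right.
- by move=> a; have [] := letter_ofP a.
Qed.

Lemma amalgam_generated :
  generated (XA `|` \bigcup_l sg_set (peripheral_A l)) = setT ->
  generated (XB `|` \bigcup_l sg_set (B_ l)) = setT ->
  generated (amalgam_gens `|` \bigcup_l sg_set (peripheral_amalgam l)) = setT.
Proof.
move=> genA genB; set S := _ `|` _; rewrite -subTset => g _.
have Ssg := @generated_subgroup _ S.
(* B comes first, because an element k of K is reached in the amalgam through xi k in B. *)
have SB y : generated S (amalgam_inr xi y).
  apply: (generated_preimage (f := amalgam_inr xi) Ssg genB) => {}y Sy.
  apply: sub_gen_smallest; case: Sy => [Xy|[nu _ Hy]].
    by left; right; exists y.
  by right; exists (inr nu) => //; exists y.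
have SA x : generated S (amalgam_inl xi x).
  apply: (generated_preimage (f := amalgam_inl xi) Ssg genA) => {}x.
  case=> [Xx|[[mu|] _ Hx]].
  - by apply: sub_gen_smallest; left; left; exists x.
  - by apply: sub_gen_smallest; right; exists (inl mu) => //; exists x.
  - pose k : K := Sub x (mem_set Hx).
    by have := SB (val (xi k)); rewrite -amalgam_glueE.
have [S1 SD] := Ssg.
have SV x : generated S x -> generated S x^-1.
  by move=> Sx; rewrite -[x^-1]mul1g; apply/set_mem/SD => //; apply/mem_set.
elim/quotW: g => u; rewrite pi_word_eval /word_eval.
elim/big_ind: _ => [|x y Sx Sy|[[x|y] e] _]; first exact/set_mem.
- by rewrite -[y]invgK; apply/set_mem/SD; apply/mem_set => //; apply: SV.
- by case: e; [apply: SV|]; apply: SA.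
- by case: e; [apply: SV|]; apply: SB.
Qed.

End Amalgam.

Theorem corollary1p5 (A B : groupType) (M N : Type)
    (A_ : M -> subgroup A) (K : subgroup A) (B_ : N -> subgroup B)
    (eta : N) (xi : {multiplicative K -> B_ eta}) :
  rel_hyperbolic (fun i : option M => if i is Some mu then A_ mu else K) ->
  rel_hyperbolic B_ ->
  finitely_generated K ->
  injective xi ->
  rel_hyperbolic (G := amalgam xi)
    (fun i : (M + N)%type =>
       match i with
       | inl mu => sg_image (amalgam_inl xi) (A_ mu)
       | inr nu => sg_image (amalgam_inr xi) (B_ nu)
       end).
Proof.
move=> /rel_hyperbolicP[XA [RA [cA [[symA genA] finXA finRA kerA areaA]]]].
move=> /rel_hyperbolicP[XB [RB [cB [[symB genB] finXB finRB kerB areaB]]]].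
move=> _ xi_inj; apply/rel_hyperbolicP.
exists (amalgam_gens XA XB).
exists (free_inl A_ xi XA XB @` RA `|` free_inr A_ xi XA XB @` RB).
(* The maximum is a common area constant for the two factors, and the stack reduction multiplies it
   by 3. *)
exists (3 * maxn cA cB)%N.
split.
- split; last exact: amalgam_generated.
  move=> _ [[x Xx <-]|[y Xy <-]].
    by left; exists x^-1; rewrite ?multiplicativeV //; apply: symA.
  by right; exists y^-1; rewrite ?multiplicativeV //; apply: symB.
- by rewrite finite_setU; split; apply: finite_image.
- by rewrite finite_setU; split; apply: finite_image.
- move=> _ [[w Rw <-]|[w Rw <-]];
    by rewrite /= ?rel_proj_free_inl ?rel_proj_free_inr ?kerA ?kerB
      ?multiplicative1.
- apply: linear_area_amalgam => // W /[dup] W1.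
    move/areaA; apply: area_le_trans; rewrite leq_mul2r leq_maxl orbT //.
  by move/areaB; apply: area_le_trans; rewrite leq_mul2r leq_maxr orbT.
Qed.
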